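(* Let $A$ be a general event structure. For every event structure with equivalence $Q$ and every map $f:\mathit{ges}(Q)\to A$ of general event structures, there is a map $h:Q\to\mathit{er}(A)$ of event structures with equivalence such that $f=\max_A\circ\mathit{ges}(h)$. Moreover, if $h':Q\to\mathit{er}(A)$ is any map of event structures with equivalence with $f=\max_A\circ\mathit{ges}(h')$, then $h'\equiv h$.
   Context: A (prime) event structure $(E,\le,\mathrm{Con})$: a set $E$, a partial order $\le$, and a nonempty family $\mathrm{Con}$ of finite subsets of $E$ such that $[e]=\{e'\mid e'\le e\}$ is finite for each $e$, $\{e\}\in\mathrm{Con}$, $\mathrm{Con}$ is closed under subsets, and $X\in\mathrm{Con}$, $e\le e'\in X$ imply $X\cup\{e\}\in\mathrm{Con}$. A configuration is a down-closed subset all of whose finite subsets lie in $\mathrm{Con}$. An event structure with equivalence (ese) $(P,\le,\mathrm{Con},\equiv)$ is an event structure with an equivalence relation $\equiv$ on $P$. A map of ese's $f:P\to Q$ is a partial function preserving $\equiv$ (if $p_1\equiv p_2$ then $f(p_1),f(p_2)$ are both undefined or both defined and $f(p_1)\equiv_Q f(p_2)$) such that for every finite configuration $x$ of $P$, the image $fx$ is a finite configuration of $Q$ and for $p_1,p_2\in x$, $f(p_1)\equiv_Q f(p_2)$ implies $p_1\equiv_P p_2$. Two maps $f_1,f_2:P\to Q$ are equivalent, $f_1\equiv f_2$, iff they are defined on the same elements and $f_1(p)\equiv_Q f_2(p)$ wherever defined. A general event structure is $(E,\mathrm{Con},\vdash)$ with $\mathrm{Con}$ a nonempty subset-closed family of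 finite subsets of $E$ and $\vdash\subseteq\mathrm{Con}\times E$ such that $Y\in\mathrm{Con}$, $X\subseteq Y$, $X\vdash e$ imply $Y\vdash e$. Its configurations are the consistent (all finite subsets in $\mathrm{Con}$) and secured (each $e\in x$ has $e_1,\dots,e_n=e$ in $x$ with $\{e_1,\dots,e_{i-1}\}\vdash e_i$) subsets; $\mathcal C^\infty(A)$ denotes them. A map of general event structures $f:(E,\mathrm{Con},\vdash)\to(E',\mathrm{Con}',\vdash')$ is a partial function such that $X\in\mathrm{Con}$ implies $fX\in\mathrm{Con}'$ and $f$ is injective on $X$ where defined, and $X\vdash e$ with $f(e)$ defined implies $fX\vdash' f(e)$. $\mathit{ges}(P)$ for an ese $P$: events are the $\equiv$-classes $P/{\equiv}$; a set $X$ of classes is consistent iff $X=\{\{p\}_\equiv\mid p\in Y\}$ for some $Y\in\mathrm{Con}$; $X\vdash e$ iff $X$ is consistent and there is $p\in P$ with $e=\{p\}_\equiv$ and $\{\{p'\}_\equiv\mid p'\le p\}\subseteq X\cup\{e\}$. For a map $f$ of ese's, $\mathit{ges}(f)$ is the partial function induced on equivalence classes. Causal realisations of a family $\mathcal A$ of sets with $A=\bigcup\mathcal A$: a partial order $(E,\le)$ with finite down-sets and $\rho:E\to A$ with $\rho x\in\mathcal A$ for all down-closed $x\subseteq E$; a map of realisations is a partial surjection preserving down-closed subsets and commuting with the $\rho$'s where defined; write $\rho'\preceq\rho$ if there is a map from $\rho$ to $\rho'$; $\rho$ is extremal if every total map out of $\rho$ is an isomorphism. $\mathit{er}(A)=(P,\le_P,\mathrm{Con}_P,\equiv_P)$: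 $P$ is a choice of one representative per isomorphism class of extremal realisations of $\mathcal C^\infty(A)$ with a top element; $\max_A(p)$ is the image of the top element; $\le_P$ is $\preceq$; finite $X$ is consistent iff $\max_A[X]\in\mathcal C^\infty(A)$ ($[X]$ the down-closure); $p_1\equiv_P p_2$ iff $\max_A(p_1)=\max_A(p_2)$. The map $\max_A:\mathit{ges}(\mathit{er}(A))\to A$ sends the class of $p$ to $\max_A(p)$. *)

(* Defs.v *)
From Stdlib Require Import List ClassicalEpsilon.
Import ListNotations.

Set Implicit Arguments.

Definition finite_set {T : Type} (X : T -> Prop) : Prop :=
  exists l : list T, forall x, X x <-> In x l.

Definition subset {T : Type} (X Y : T -> Prop) : Prop := forall x, X x -> Y x.

Definition pimage {T U : Type} (f : T -> option U) (X : T -> Prop) : U -> Prop :=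
  fun u => exists t, X t /\ f t = Some u.

Definition timage {T U : Type} (f : T -> U) (X : T -> Prop) : U -> Prop :=
  fun u => exists t, X t /\ f t = u.

Definition opt_rel {U : Type} (R : U -> U -> Prop) (a b : option U) : Prop :=
  match a, b with
  | None, None => True
  | Some x, Some y => R x y
  | _, _ => False
  end.

Definition option_bind {T U : Type} (f : T -> option U) (a : option T) : option U :=
  match a with Some x => f x | None => None end.

Record ese := {
  ev  : Type;
  le  : ev -> ev -> Prop;
  con : (ev -> Prop) -> Prop;
  eqv : ev -> ev -> Prop
}.

Definition is_ese (P : ese) : Prop :=
  (forall e, le P e e) /\
  (forall e1 e2 e3, le P e1 e2 -> le P e2 e3 -> le P e1 e3) /\
  (forall e1 e2, le P e1 e2 -> le P e2 e1 -> e1 = e2) /\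
  (exists X, con P X) /\
  (forall X, con P X -> finite_set X) /\
  (forall e, finite_set (fun e' => le P e' e)) /\
  (forall e, con P (fun e' => e' = e)) /\
  (forall X Y, con P Y -> subset X Y -> con P X) /\
  (forall X e e', con P X -> X e' -> le P e e' -> con P (fun x => X x \/ x = e)) /\
  (forall e, eqv P e e) /\
  (forall e1 e2, eqv P e1 e2 -> eqv P e2 e1) /\
  (forall e1 e2 e3, eqv P e1 e2 -> eqv P e2 e3 -> eqv P e1 e3).

Definition ese_config (P : ese) (x : ev P -> Prop) : Prop :=
  (forall e e', x e' -> le P e e' -> x e) /\
  (forall X, finite_set X -> subset X x -> con P X).

Definition ese_fin_config (P : ese) (x : ev P -> Prop) : Prop :=
  ese_config P x /\ finite_set x.

Definition is_ese_map (P Q : ese) (f : ev P -> option (ev Q)) : Prop :=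
  (forall p1 p2, eqv P p1 p2 -> opt_rel (eqv Q) (f p1) (f p2)) /\
  (forall x, ese_fin_config P x ->
     ese_fin_config Q (pimage f x) /\
     (forall p1 p2 q1 q2, x p1 -> x p2 -> f p1 = Some q1 -> f p2 = Some q2 ->
        eqv Q q1 q2 -> eqv P p1 p2)).

Definition ese_map_equiv (P Q : ese) (f1 f2 : ev P -> option (ev Q)) : Prop :=
  forall p, opt_rel (eqv Q) (f1 p) (f2 p).

Record ges := {
  gev   : Type;
  gcon  : (gev -> Prop) -> Prop;
  genab : (gev -> Prop) -> gev -> Prop
}.

Definition is_ges (A : ges) : Prop :=
  (exists X, gcon A X) /\
  (forall X, gcon A X -> finite_set X) /\
  (forall X Y, gcon A Y -> subset X Y -> gcon A X) /\
  (forall X e, genab A X e -> gcon A X) /\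
  (forall X Y e, gcon A Y -> subset X Y -> genab A X e -> genab A Y e).

Definition securing_chain (A : ges) (x : gev A -> Prop) (l : list (gev A)) : Prop :=
  forall i a, nth_error l i = Some a ->
    x a /\ genab A (fun b => In b (firstn i l)) a.

Definition ges_config (A : ges) (x : gev A -> Prop) : Prop :=
  (forall X, finite_set X -> subset X x -> gcon A X) /\
  (forall e, x e -> exists l, securing_chain A x (l ++ [e])).

Definition is_ges_map (A B : ges) (f : gev A -> option (gev B)) : Prop :=
  (forall X, gcon A X ->
     gcon B (pimage f X) /\
     (forall a1 a2 b, X a1 -> X a2 -> f a1 = Some b -> f a2 = Some b -> a1 = a2)) /\
  (forall X e b, genab A X e -> f e = Some b -> genab B (pimage f X) b).

Definition cls (P : ese) : Type := { c : ev P -> Prop | exists p, c = eqv P p }.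

Definition clsOf (P : ese) (p : ev P) : cls P :=
  exist _ (eqv P p) (ex_intro _ p eq_refl).

Definition repr (P : ese) (c : cls P) : ev P :=
  proj1_sig (constructive_indefinite_description _ (proj2_sig c)).

Definition ges_of (P : ese) : ges := {|
  gev := cls P;
  gcon := fun X => exists Y, con P Y /\ (forall c, X c <-> exists p, Y p /\ c = clsOf P p);
  genab := fun X e =>
     (exists Y, con P Y /\ (forall c, X c <-> exists p, Y p /\ c = clsOf P p)) /\
     exists p, e = clsOf P p /\
       (forall p', le P p' p -> X (clsOf P p') \/ clsOf P p' = e)
|}.

Definition ges_map (P Q : ese) (h : ev P -> option (ev Q)) : cls P -> option (cls Q) :=
  fun c => option_map (@clsOf Q) (h (repr c)).

Record realisation (A : ges) := {
  r_ev  : Type;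
  r_le  : r_ev -> r_ev -> Prop;
  r_rho : r_ev -> gev A
}.

Definition r_down_closed (A : ges) (r : realisation A) (x : r_ev r -> Prop) : Prop :=
  forall e e', x e' -> r_le r e e' -> x e.

Definition is_realisation (A : ges) (r : realisation A) : Prop :=
  (forall e, r_le r e e) /\
  (forall e1 e2 e3, r_le r e1 e2 -> r_le r e2 e3 -> r_le r e1 e3) /\
  (forall e1 e2, r_le r e1 e2 -> r_le r e2 e1 -> e1 = e2) /\
  (forall e, finite_set (fun e' => r_le r e' e)) /\
  (forall x, r_down_closed r x -> ges_config A (timage (r_rho r) x)).

Definition is_real_map (A : ges) (r r' : realisation A)
    (g : r_ev r -> option (r_ev r')) : Prop :=
  (forall e', exists e, g e = Some e') /\
  (forall x, r_down_closed r x -> r_down_closed r' (pimage g x)) /\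
  (forall e e', g e = Some e' -> r_rho r' e' = r_rho r e).

Definition is_real_iso (A : ges) (r r' : realisation A)
    (g : r_ev r -> option (r_ev r')) : Prop :=
  is_real_map r r' g /\
  exists g', is_real_map r' r g' /\
    (forall e, option_bind g' (g e) = Some e) /\
    (forall e', option_bind g (g' e') = Some e').

Definition real_isomorphic (A : ges) (r r' : realisation A) : Prop :=
  exists g, is_real_iso r r' g.

Definition preceq (A : ges) (r' r : realisation A) : Prop :=
  exists g, is_real_map r r' g.

Definition is_extremal (A : ges) (r : realisation A) : Prop :=
  forall (r' : realisation A) (g : r_ev r -> option (r_ev r')),
    is_realisation r' -> is_real_map r r' g ->
    (forall e, exists e', g e = Some e') -> is_real_iso r r' g.

Definition is_top (A : ges) (r : realisation A) (t : r_ev r) : Prop :=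
  forall e, r_le r e t.

Record trealisation (A : ges) := {
  tr   : realisation A;
  ttop : r_ev tr
}.

(* Rep is "a choice of one representative per isomorphism class of extremal
   realisations of C^oo(A) with a top element" *)
Definition is_rep_choice (A : ges) (Rep : trealisation A -> Prop) : Prop :=
  (forall t, Rep t ->
     is_realisation (tr t) /\ is_extremal (tr t) /\ is_top (tr t) (ttop t)) /\
  (forall (r : realisation A) (t0 : r_ev r),
     is_realisation r -> is_extremal r -> is_top r t0 ->
     exists t, Rep t /\ real_isomorphic (tr t) r) /\
  (forall t1 t2, Rep t1 -> Rep t2 -> real_isomorphic (tr t1) (tr t2) -> t1 = t2).

Definition er_ev (A : ges) (Rep : trealisation A -> Prop) : Type :=
  { t : trealisation A | Rep t }.

Definition maxA (A : ges) (Rep : trealisation A -> Prop) (p : er_ev Rep) : gev A :=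
  r_rho (tr (proj1_sig p)) (ttop (proj1_sig p)).

Definition er_le (A : ges) (Rep : trealisation A -> Prop) (p1 p2 : er_ev Rep) : Prop :=
  preceq (tr (proj1_sig p1)) (tr (proj1_sig p2)).

Definition er (A : ges) (Rep : trealisation A -> Prop) : ese := {|
  ev  := er_ev Rep;
  le  := @er_le A Rep;
  con := fun X => finite_set X /\
           ges_config A (timage (@maxA A Rep) (fun p => exists p', X p' /\ er_le p p'));
  eqv := fun p1 p2 => maxA p1 = maxA p2
|}.
Arguments er : clear implicits.

Definition maxA_ges (A : ges) (Rep : trealisation A -> Prop)
    (c : gev (ges_of (er A Rep))) : gev A :=
  @maxA A Rep (repr c).

Definition maxA_after (A : ges) (Rep : trealisation A -> Prop) (Q : ese)
    (h : ev Q -> option (ev (er A Rep))) : gev (ges_of Q) -> option (gev A) :=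
  fun c => option_map (@maxA_ges A Rep) (@ges_map Q (er A Rep) h c).

(* Main.v *)
(** The map [h] is built by recursion on the finite down-sets of [Q].  Given [h] below [q]
    with [f q = a], the events [h q'] for [q' < q] together with a new top labelled [a] form
    a finite realisation; it maps to an extremal realisation, top to top, and [h q] is its
    representative.  A partial map out of an extremal
    realisation becomes total once its undefined events are kept in the target, hence is
    injective and monotone with down-closed domain; so [p' <= p] in [er A] exactly when [p'] is
    the restriction of [p] below one of its events.  Consequently everything strictly below
    [h q] is already some [h q'] with [q' < q], and [h] preserves down-closed sets. *)
From Stdlib Require Import List Arith Lia ClassicalEpsilon ProofIrrelevance
  FunctionalExtensionality PropExtensionality.
Require Import Defs.
Import ListNotations.

Set Implicit Arguments.

(** * Extensionality, finite sets and partial functions on them *)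

Lemma pred_ext {T : Type} (X Y : T -> Prop) : (forall x, X x <-> Y x) -> X = Y.
Proof.
  intros H. apply functional_extensionality. intros x.
  apply propositional_extensionality, H.
Qed.

Lemma classical_eq_dec {T : Type} (x y : T) : {x = y} + {x <> y}.
Proof. apply excluded_middle_informative. Qed.

Definition omap {T U : Type} (f : T -> option U) (l : list T) : list U :=
  flat_map (fun x => match f x with Some y => [y] | None => [] end) l.

Lemma in_omap {T U : Type} (f : T -> option U) l y :
  In y (omap f l) <-> exists x, In x l /\ f x = Some y.
Proof.
  unfold omap. rewrite in_flat_map. split.
  - intros [x [Hx Hy]]. exists x. split; [exact Hx|].
    destruct (f x); simpl in Hy; [destruct Hy as [->|[]]; reflexivity | contradiction].
  - intros [x [Hx Hy]]. exists x. rewrite Hy. simpl. auto.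
Qed.

Lemma length_omap {T U : Type} (f : T -> option U) l : length (omap f l) <= length l.
Proof.
  induction l as [|x l IH]; simpl; [lia|].
  destruct (f x); simpl; unfold omap in *; lia.
Qed.

Lemma length_omap_lt {T U : Type} (f : T -> option U) l x :
  In x l -> f x = None -> length (omap f l) < length l.
Proof.
  induction l as [|z l IH]; simpl; [tauto|]. intros [->|H] Hf.
  - rewrite Hf. simpl. pose proof (length_omap f l). unfold omap in *. lia.
  - specialize (IH H Hf). unfold omap in *. destruct (f z); simpl; lia.
Qed.

(** A list of all elements without repetition cannot be covered by its own image under [g] if [g]
    drops one of them: the image list would be strictly shorter. *)
Lemma partial_surjection_total {T : Type} (g : T -> option T) :
  finite_set (fun _ : T => True) -> (forall y, exists x, g x = Some y) ->
  forall x, exists y, g x = Some y.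
Proof.
  intros [l Hl] Hs x. destruct (g x) as [y|] eqn:E; [eauto|]. exfalso.
  set (k := nodup classical_eq_dec l).
  assert (Hk : forall z, In z k) by (intros z; apply nodup_In, Hl; exact I).
  pose proof (@length_omap_lt _ _ g k x (Hk x) E).
  assert (length k <= length (omap g k)).
  { apply NoDup_incl_length; [apply NoDup_nodup|].
    intros y _. apply in_omap. destruct (Hs y) as [z Hz]. eauto. }
  lia.
Qed.

Lemma finite_subset {T : Type} (X Y : T -> Prop) :
  finite_set Y -> subset X Y -> finite_set X.
Proof.
  intros [l Hl] H.
  exists (filter (fun x => if excluded_middle_informative (X x) then true else false) l).
  intros x. rewrite filter_In. destruct (excluded_middle_informative (X x)).
  - split; auto. intros _. split; auto. apply Hl, H; auto.
  - split; [tauto|]. intros [_ ?]; discriminate.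
Qed.

Lemma finite_pimage {T U : Type} (f : T -> option U) X :
  finite_set X -> finite_set (pimage f X).
Proof.
  intros [l Hl]. exists (omap f l). intros y. rewrite in_omap. unfold pimage.
  split; intros [x [Hx Hf]]; exists x; split; auto; apply Hl; auto.
Qed.

Lemma finite_timage {T U : Type} (f : T -> U) X :
  finite_set X -> finite_set (timage f X).
Proof.
  intros [l Hl]. exists (map f l). intros y. rewrite in_map_iff. unfold timage.
  split; intros [x [Hx Hf]]; exists x; split; auto; apply Hl; auto.
Qed.

Definition sub_opt {T : Type} (P : T -> Prop) (x : T) : option {x | P x} :=
  match excluded_middle_informative (P x) with
  | left H => Some (exist _ x H)
  | right _ => None
  end.

Lemma sig_eq {T : Type} (P : T -> Prop) (x y : {x | P x}) :
  proj1_sig x = proj1_sig y -> x = y.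
Proof.
  destruct x as [x Hx], y as [y Hy]. simpl. intros <-. f_equal. apply proof_irrelevance.
Qed.

Lemma sub_opt_Some {T : Type} (P : T -> Prop) x (y : {x | P x}) :
  sub_opt P x = Some y <-> proj1_sig y = x.
Proof.
  unfold sub_opt. destruct (excluded_middle_informative (P x)) as [H|H].
  - split.
    + intros [= <-]. reflexivity.
    + intros E. f_equal. apply sig_eq. simpl. auto.
  - split; [discriminate|]. intros <-. destruct H. exact (proj2_sig y).
Qed.

Lemma finite_sig {T : Type} (P Q : T -> Prop) :
  finite_set Q -> finite_set (fun x : {x | P x} => Q (proj1_sig x)).
Proof.
  intros H. apply (finite_subset (finite_pimage (sub_opt P) H)).
  intros x Hx. exists (proj1_sig x). split; [exact Hx|]. apply sub_opt_Some. reflexivity.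
Qed.

Lemma finite_sig_all {T : Type} (P : T -> Prop) :
  finite_set P -> finite_set (fun _ : {x | P x} => True).
Proof.
  intros H. apply (finite_subset (finite_sig P H)).
  intros x _. exact (proj2_sig x).
Qed.

(** * Configurations and securing chains of a general event structure *)

Definition ges_consistent (A : ges) (x : gev A -> Prop) : Prop :=
  forall X, finite_set X -> subset X x -> gcon A X.

Lemma securing_chain_subset (A : ges) (x y : gev A -> Prop) l :
  subset x y -> securing_chain A x l -> securing_chain A y l.
Proof. intros H C i a E. destruct (C i a E). split; auto. Qed.

(** Enabling is monotone within consistent sets, so an event of [l2] stays enabled when all of [l1]
    is placed in front. *)
Lemma securing_chain_app (A : ges) (x : gev A -> Prop) l1 l2 :
  is_ges A -> ges_consistent A x ->
  securing_chain A x l1 -> securing_chain A x l2 -> securing_chain A x (l1 ++ l2).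
Proof.
  intros (_ & _ & _ & _ & Hen) Hc C1 C2.
  assert (Hin : forall b, In b (l1 ++ l2) -> x b).
  { intros b Hb. apply in_app_or in Hb.
    destruct Hb as [Hb|Hb]; apply In_nth_error in Hb; destruct Hb as [i Hi];
      [apply (C1 i b Hi) | apply (C2 i b Hi)]. }
  intros i a E. split; [apply Hin, (nth_error_In _ _ E)|].
  destruct (lt_dec i (length l1)) as [Hi|Hi].
  - rewrite nth_error_app1 in E by exact Hi.
    replace (fun b => In b (firstn i (l1 ++ l2))) with (fun b => In b (firstn i l1)).
    + apply C1, E.
    + rewrite firstn_app. replace (i - length l1) with 0 by lia.
      simpl. rewrite app_nil_r. reflexivity.
  - rewrite nth_error_app2 in E by lia.
    destruct (C2 _ _ E) as [_ Hab].
    refine (Hen _ _ a _ _ Hab).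
    + apply Hc.
      * exists (firstn i (l1 ++ l2)). tauto.
      * intros b Hb. apply Hin. rewrite <- (firstn_skipn i). apply in_or_app. auto.
    + intros b Hb. rewrite firstn_app. apply in_or_app. auto.
Qed.

Lemma finite_config_chain (A : ges) (x : gev A -> Prop) :
  is_ges A -> ges_config A x -> finite_set x ->
  exists l, securing_chain A x l /\ forall b, x b <-> In b l.
Proof.
  intros HA [Hc Hs] [k Hk].
  assert (exists l, securing_chain A x l /\ forall b, In b k -> In b l) as [l [Hl Hkl]].
  { assert (Hx : forall b, In b k -> x b) by (intros b; apply Hk). clear Hk.
    induction k as [|a k IH].
    - exists []. split; [|simpl; tauto]. intros [|i] a E; discriminate.
    - destruct IH as [l [Hl Hkl]]; [simpl in Hx; auto|].
      destruct (Hs a) as [l' Hl']; [apply Hx; simpl; auto|].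
      exists ((l' ++ [a]) ++ l). split; [apply securing_chain_app; auto|].
      intros b [->|Hb]; apply in_or_app; [left|right; auto].
      apply in_or_app. simpl. auto. }
  exists l. split; [exact Hl|]. intros b. split.
  - intros Hb. apply Hkl, Hk, Hb.
  - intros Hb. apply In_nth_error in Hb. destruct Hb as [i Hi]. apply (Hl i b Hi).
Qed.

(** A chain exhausting [x] followed by [a] secures [a], because [x] as a whole enables [a]. *)
Lemma config_add_enabled (A : ges) (x : gev A -> Prop) a :
  is_ges A -> ges_config A x -> finite_set x -> genab A x a ->
  ges_consistent A (fun b => x b \/ b = a) -> ges_config A (fun b => x b \/ b = a).
Proof.
  intros HA Hx Hf Hab Hc. split; [exact Hc|].
  intros e [He| ->].
  - destruct Hx as [_ Hs]. destruct (Hs e He) as [l Hl]. exists l.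
    apply (@securing_chain_subset _ x); [intros b; auto|exact Hl].
  - destruct (finite_config_chain HA Hx Hf) as [l [Hl Hxl]]. exists l.
    intros i b E. destruct (lt_dec i (length l)) as [Hi|Hi].
    + rewrite nth_error_app1 in E by exact Hi.
      destruct (Hl i b E) as [Hb Hen]. split; [auto|].
      rewrite firstn_app. replace (i - length l) with 0 by lia.
      simpl. rewrite app_nil_r. exact Hen.
    + rewrite nth_error_app2 in E by lia.
      destruct (i - length l) as [|j] eqn:Ej; [|destruct j; discriminate].
      injection E as <-. split; [auto|].
      rewrite firstn_app, Ej. simpl. rewrite app_nil_r.
      rewrite firstn_all2 by lia.
      replace (fun b => In b l) with x; [exact Hab|]. apply pred_ext, Hxl.
Qed.

Definition total_map {T U : Type} (g : T -> option U) : Prop :=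
  forall e, exists e', g e = Some e'.

(** * Maps of realisations *)

(** Preservation of down-closed sets, applied to the down-set of [b], becomes a lifting property;
    [real_map_intro] goes back. Maps are handled in this form below. *)
Lemma real_map_lift (A : ges) (r r' : realisation A) g b b' a' :
  is_realisation r -> is_real_map r r' g -> g b = Some b' -> r_le r' a' b' ->
  exists a, r_le r a b /\ g a = Some a'.
Proof.
  intros (Hr & Ht & _) (_ & Hd & _) Hb Hle.
  apply (Hd (fun a => r_le r a b)) with (e' := b'); [|exists b; auto|exact Hle].
  intros e e' H1 H2. eauto.
Qed.

Arguments real_map_lift {A r r' g b b' a'} _ _ _ _.

Lemma real_map_intro (A : ges) (r r' : realisation A) g :
  (forall e', exists e, g e = Some e') ->
  (forall b b' a', g b = Some b' -> r_le r' a' b' ->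
     exists a, r_le r a b /\ g a = Some a') ->
  (forall e e', g e = Some e' -> r_rho r' e' = r_rho r e) ->
  is_real_map r r' g.
Proof.
  intros Hs Hl Hr. split; [exact Hs|]. split; [|exact Hr].
  intros x Hx a' b' [b [Hb E]] Hle.
  destruct (Hl b b' a' E Hle) as [a [Ha Ea]]. exists a. split; [|exact Ea].
  apply (Hx a b Hb Ha).
Qed.

Lemma real_map_id (A : ges) (r : realisation A) : is_real_map r r (fun e => Some e).
Proof.
  apply real_map_intro.
  - eauto.
  - intros b b' a' [= <-] H. eauto.
  - intros e e' [= <-]. reflexivity.
Qed.

Lemma option_bind_Some {T U V : Type} (g : U -> option V) (k : T -> option U) e v :
  option_bind g (k e) = Some v <-> exists u, k e = Some u /\ g u = Some v.
Proof.
  destruct (k e) as [u|]; simpl.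
  - split; [eauto|]. intros [u' [[= <-] H]]. exact H.
  - split; [discriminate|]. intros [u' [H _]]. discriminate.
Qed.

Lemma real_map_comp (A : ges) (r1 r2 r3 : realisation A) g k :
  is_realisation r1 -> is_realisation r2 ->
  is_real_map r1 r2 g -> is_real_map r2 r3 k ->
  is_real_map r1 r3 (fun e => option_bind k (g e)).
Proof.
  intros H1 H2 Hg Hk. apply real_map_intro.
  - intros c. destruct (proj1 Hk c) as [b Hb]. destruct (proj1 Hg b) as [a Ha].
    exists a. apply option_bind_Some. eauto.
  - intros a c c' Hac Hle. apply option_bind_Some in Hac. destruct Hac as [b [Hab Hbc]].
    destruct (real_map_lift H2 Hk Hbc Hle) as [b1 [Hb1 Eb1]].
    destruct (real_map_lift H1 Hg Hab Hb1) as [a1 [Ha1 Ea1]].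
    exists a1. split; [exact Ha1|]. apply option_bind_Some. eauto.
  - intros a c Hac. apply option_bind_Some in Hac. destruct Hac as [b [Hab Hbc]].
    destruct Hg as (_ & _ & Hg), Hk as (_ & _ & Hk).
    rewrite (Hk _ _ Hbc). apply Hg, Hab.
Qed.

(** Lifting for the inverse function is monotonicity of [g], which maps of realisations do not have
    in general. *)
Lemma real_iso_intro (A : ges) (r r' : realisation A) g :
  is_real_map r r' g -> total_map g ->
  (forall a b c, g a = Some c -> g b = Some c -> a = b) ->
  (forall a b a' b', g a = Some a' -> g b = Some b' -> r_le r a b -> r_le r' a' b') ->
  is_real_iso r r' g.
Proof.
  intros Hg Ht Hi Hm. split; [exact Hg|].
  destruct Hg as (Hs & _ & Hr).
  set (k := fun e' => proj1_sig (constructive_indefinite_description _ (Hs e'))).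
  assert (Hk : forall e', g (k e') = Some e').
  { intros e'. unfold k. apply proj2_sig. }
  assert (Hk' : forall e e', g e = Some e' -> k e' = e).
  { intros e e' E. apply (Hi _ _ e'); auto. }
  exists (fun e' => Some (k e')). split; [|split].
  - apply real_map_intro.
    + intros e. destruct (Ht e) as [e' E]. exists e'. f_equal. apply Hk', E.
    + intros b' b a [= <-] Hle. destruct (Ht a) as [a' Ea].
      exists a'. split; [|f_equal; apply Hk', Ea].
      apply (Hm _ _ _ _ Ea (Hk b') Hle).
    + intros e' e [= <-]. symmetry. apply Hr, Hk.
  - intros e. destruct (Ht e) as [e' E]. rewrite E. simpl. f_equal. apply Hk', E.
  - intros e'. simpl. apply Hk.
Qed.

Lemma real_iso_elim (A : ges) (r r' : realisation A) g :
  is_realisation r' -> is_real_iso r r' g ->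
  total_map g /\
  (forall a b c, g a = Some c -> g b = Some c -> a = b) /\
  (forall a b a' b', g a = Some a' -> g b = Some b' -> r_le r a b -> r_le r' a' b').
Proof.
  intros Hr' [Hg [k [Hk [H1 H2]]]].
  assert (Hgk : forall a a', g a = Some a' -> k a' = Some a).
  { intros a a' E. specialize (H1 a). rewrite E in H1. exact H1. }
  split; [|split].
  - intros e. specialize (H1 e). destruct (g e); [eauto|discriminate].
  - intros a b c Ea Eb. apply Hgk in Ea. apply Hgk in Eb. congruence.
  - intros a b a' b' Ea Eb Hle.
    destruct (real_map_lift Hr' Hk (Hgk _ _ Eb) Hle) as [c [Hc Ec]].
    specialize (H2 c). rewrite Ec in H2. simpl in H2.
    replace a' with c by congruence. exact Hc.
Qed.

Lemma real_isomorphic_sym (A : ges) (r r' : realisation A) :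
  real_isomorphic r r' -> real_isomorphic r' r.
Proof. intros [g [Hg [k [Hk [H1 H2]]]]]. exists k. split; eauto. Qed.

Lemma real_isomorphic_trans (A : ges) (r1 r2 r3 : realisation A) :
  is_realisation r1 -> is_realisation r2 -> is_realisation r3 ->
  real_isomorphic r1 r2 -> real_isomorphic r2 r3 -> real_isomorphic r1 r3.
Proof.
  intros R1 R2 R3 [g [Hg [g' [Hg' [G1 G2]]]]] [k [Hk [k' [Hk' [K1 K2]]]]].
  exists (fun e => option_bind k (g e)). split; [apply (real_map_comp R1 R2 Hg Hk)|].
  exists (fun e => option_bind g' (k' e)). split; [apply (real_map_comp R3 R2 Hk' Hg')|].
  split; intros e.
  - specialize (G1 e). destruct (g e) as [b|]; [simpl in *|discriminate].
    specialize (K1 b). destruct (k b) as [c|]; [simpl in *|discriminate].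
    rewrite K1. exact G1.
  - specialize (K2 e). destruct (k' e) as [b|]; [simpl in *|discriminate].
    specialize (G2 b). destruct (g' b) as [c|]; [simpl in *|discriminate].
    rewrite G2. exact K2.
Qed.

Lemma iso_top (A : ges) (r r' : realisation A) g t t' :
  is_realisation r' -> is_real_iso r r' g -> is_top r t -> is_top r' t' ->
  g t = Some t'.
Proof.
  intros Hr' Hg Ht Ht'. destruct (real_iso_elim Hr' Hg) as [Htot [_ Hm]].
  destruct (Htot t) as [s Hs]. rewrite Hs. f_equal.
  destruct Hg as [[Hsurj _] _]. destruct (Hsurj t') as [e He].
  destruct Hr' as (_ & _ & Has & _). apply Has; [apply Ht'|].
  apply (Hm _ _ _ _ He Hs), Ht.
Qed.

(** * Extremal realisations *)

(* The order puts below an undefined event [u] the images of the events below [u];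
   no undefined event lies below an event of [r'].  This makes a partial map total. *)
Definition glue (A : ges) (r r' : realisation A) (m : r_ev r -> option (r_ev r')) :
    realisation A := {|
  r_ev := r_ev r' + {u | m u = None};
  r_le := fun x y =>
    match x, y with
    | inl a, inl b => r_le r' a b
    | inl a, inr u => exists v, r_le r v (proj1_sig u) /\ m v = Some a
    | inr u, inr v => r_le r (proj1_sig u) (proj1_sig v)
    | inr _, inl _ => False
    end;
  r_rho := fun x => match x with inl a => r_rho r' a | inr u => r_rho r (proj1_sig u) end
|}.

Definition glue_map (A : ges) (r r' : realisation A) (m : r_ev r -> option (r_ev r'))
    (e : r_ev r) : option (r_ev (glue r r' m)) :=
  match m e with
  | Some a => Some (inl a)
  | None => option_map inr (sub_opt (fun u => m u = None) e)
  end.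

Lemma glue_map_inl (A : ges) (r r' : realisation A) m e a :
  @glue_map A r r' m e = Some (inl a) <-> m e = Some a.
Proof.
  unfold glue_map. destruct (m e); [split; intros [= <-]; reflexivity|].
  destruct (sub_opt _ e); simpl; split; discriminate.
Qed.

Lemma glue_map_inr (A : ges) (r r' : realisation A) m e u :
  @glue_map A r r' m e = Some (inr u) <-> proj1_sig u = e.
Proof.
  unfold glue_map. destruct (m e) eqn:E.
  - split; [discriminate|]. destruct u as [u Hu]. simpl. congruence.
  - rewrite <- sub_opt_Some. destruct (sub_opt _ e); simpl.
    + split; intros [= ->]; reflexivity.
    + split; discriminate.
Qed.

Lemma glue_map_total (A : ges) (r r' : realisation A) m : total_map (@glue_map A r r' m).
Proof.
  intros e. destruct (m e) eqn:E.
  - eexists. apply glue_map_inl, E.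
  - exists (inr (exist _ e E)). apply glue_map_inr. reflexivity.
Qed.

Lemma glue_is_realisation (A : ges) (r r' : realisation A) m :
  is_realisation r -> is_realisation r' -> is_real_map r r' m ->
  is_realisation (glue r r' m).
Proof.
  intros R R' M.
  pose proof R as (Rr & Rt & Ra & Rf & Rc).
  pose proof R' as (Rr' & Rt' & Ra' & Rf' & Rc').
  pose proof M as (Ms & Md & Mr).
  split; [|split; [|split; [|split]]].
  - intros [a|u]; simpl; auto.
  - intros [a|u] [b|v] [c|w]; simpl; try tauto; eauto.
    + intros Hab [v [Hv Ev]]. destruct (real_map_lift R M Ev Hab) as [x [Hx Ex]]. eauto.
    + intros [x [Hx Ex]] Hvw. eauto.
  - intros [a|u] [b|v]; simpl; try tauto.
    + intros H1 H2. f_equal. auto.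
    + intros H1 H2. f_equal. apply sig_eq. auto.
  - intros [a|u].
    + apply (finite_subset (finite_timage inl (Rf' a))).
      intros [b|v] H; simpl in H; [exists b; auto|contradiction].
    + apply (finite_subset (finite_pimage (@glue_map A r r' m) (Rf (proj1_sig u)))).
      intros [b|v] H; simpl in H.
      * destruct H as [v [Hv Ev]]. exists v. split; [exact Hv|].
        apply glue_map_inl, Ev.
      * exists (proj1_sig v). split; [exact H|]. apply glue_map_inr. reflexivity.
  - intros x Hx. split.
    (* Every label of the glued realisation already labels an event of [r], as [m] is onto, so
       consistency comes from the whole of [r]. *)
    + intros X HX Hsub. apply (Rc (fun _ => True)); [intros ?; auto|exact HX|].
      intros c Hc. destruct (Hsub c Hc) as [[a|u] [Ha Ec]]; simpl in Ec.
      * destruct (Ms a) as [e He]. exists e. split; [exact I|].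
        rewrite <- Ec. symmetry. apply Mr, He.
      * exists (proj1_sig u). auto.
    + intros c [[a|u] [Ha Ec]]; simpl in Ec.
      * destruct (Rc' (fun b => r_le r' b a)) as [_ Hs]; [intros ? ? ? ?; eauto|].
        destruct (Hs c) as [l Hl]; [exists a; auto|]. exists l.
        apply (securing_chain_subset (y := timage (r_rho (glue r r' m)) x)) in Hl; auto.
        intros d [b [Hb Eb]]. exists (inl b). split; [|exact Eb].
        apply (Hx (inl b) (inl a) Ha Hb).
      (* An undefined event is secured by the chain of its down-set in [r]; events where [m] is
         defined are replaced by their images, which carry the same labels. *)
      * destruct (Rc (fun b => r_le r b (proj1_sig u))) as [_ Hs]; [intros ? ? ? ?; eauto|].
        destruct (Hs c) as [l Hl]; [exists (proj1_sig u); auto|]. exists l.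
        apply (securing_chain_subset (y := timage (r_rho (glue r r' m)) x)) in Hl; auto.
        intros d [b [Hb Eb]]. destruct (m b) as [b'|] eqn:Em.
        -- exists (inl b'). split; [|simpl; rewrite <- Eb; apply Mr, Em].
           apply (Hx _ (inr u) Ha). simpl. eauto.
        -- exists (inr (exist _ b Em)). split; [|exact Eb].
           apply (Hx _ (inr u) Ha). exact Hb.
Qed.

Lemma glue_map_is_real_map (A : ges) (r r' : realisation A) m :
  is_realisation r -> is_real_map r r' m ->
  is_real_map r (glue r r' m) (@glue_map A r r' m).
Proof.
  intros R M. apply real_map_intro.
  - intros [a|u].
    + destruct (proj1 M a) as [e He]. exists e. apply glue_map_inl, He.
    + exists (proj1_sig u). apply glue_map_inr. reflexivity.
  - intros b [b'|u] [a'|v] E Hle; simpl in Hle.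
    + apply -> glue_map_inl in E. destruct (real_map_lift R M E Hle) as [a [Ha Ea]].
      exists a. split; [exact Ha|]. apply glue_map_inl, Ea.
    + contradiction.
    + apply -> glue_map_inr in E. subst b. destruct Hle as [v [Hv Ev]].
      exists v. split; [exact Hv|]. apply glue_map_inl, Ev.
    + apply -> glue_map_inr in E. subst b. exists (proj1_sig v). split; [exact Hle|].
      apply glue_map_inr. reflexivity.
  - intros e [a|u] E.
    + apply -> glue_map_inl in E. simpl. apply M, E.
    + apply -> glue_map_inr in E. subst e. reflexivity.
Qed.

(** Extremality makes the total map [glue_map] an isomorphism; injectivity and monotonicity are
    inherited by [m], and the domain is down-closed because [glue] puts no undefined event below one
    of [r']. *)
Lemma extremal_map (A : ges) (r r' : realisation A) m :
  is_realisation r -> is_extremal r -> is_realisation r' -> is_real_map r r' m ->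
  (forall a b c, m a = Some c -> m b = Some c -> a = b) /\
  (forall a b a' b', m a = Some a' -> m b = Some b' -> r_le r a b -> r_le r' a' b') /\
  (forall a b b', m b = Some b' -> r_le r a b -> exists a', m a = Some a').
Proof.
  intros R X R' M.
  pose proof (glue_is_realisation R R' M) as RG.
  pose proof (X _ _ RG (glue_map_is_real_map R M) (@glue_map_total A r r' m)) as I.
  destruct (real_iso_elim RG I) as (_ & Hi & Hm). split; [|split].
  - intros a b c Ea Eb. apply <- glue_map_inl in Ea. apply <- glue_map_inl in Eb. apply (Hi _ _ _ Ea Eb).
  - intros a b a' b' Ea Eb Hle. apply <- glue_map_inl in Ea. apply <- glue_map_inl in Eb. apply (Hm _ _ _ _ Ea Eb Hle).
  - intros a b b' Eb Hle. apply <- glue_map_inl in Eb.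
    destruct (glue_map_total r r' m a) as [[a'|u] Ea].
    + exists a'. apply glue_map_inl, Ea.
    + destruct (Hm _ _ _ _ Ea Eb Hle).
Qed.

(** A total [k] out of [r'] is injective and monotone because its composite with [m], a map out of
    the extremal [r], is so, and events of [r'] lift along [m]. *)
Lemma extremal_image (A : ges) (r r' : realisation A) m :
  is_realisation r -> is_extremal r -> is_realisation r' -> is_real_map r r' m ->
  is_extremal r'.
Proof.
  intros R X R' M s k S K T.
  destruct (extremal_map R X R' M) as (Mi & Mm & Md).
  destruct (extremal_map R X S (real_map_comp R R' M K)) as (Ci & Cm & _).
  apply real_iso_intro; auto.
  - intros a' b' c Ea Eb.
    destruct (proj1 M a') as [a Ha], (proj1 M b') as [b Hb].
    assert (a = b) by (apply (Ci a b c); apply option_bind_Some; eauto).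
    congruence.
  - intros a' b' a'' b'' Ea Eb Hle.
    destruct (proj1 M b') as [b Hb].
    destruct (real_map_lift R M Hb Hle) as [a [Hab Ha]].
    apply (Cm a b); auto; apply option_bind_Some; eauto.
Qed.

(** The domain of [m] is down-closed and contains the top, so [m] is total. *)
Lemma extremal_top_map_iso (A : ges) (r r' : realisation A) m t t' :
  is_realisation r -> is_extremal r -> is_realisation r' -> is_real_map r r' m ->
  is_top r t -> m t = Some t' -> is_real_iso r r' m.
Proof.
  intros R X R' M Ht E. apply X; auto.
  intros e. destruct (extremal_map R X R' M) as (_ & _ & Md).
  apply (Md e t t' E), Ht.
Qed.

Definition restr (A : ges) (r : realisation A) (e : r_ev r) : realisation A := {|
  r_ev := {x | r_le r x e};
  r_le := fun x y => r_le r (proj1_sig x) (proj1_sig y);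
  r_rho := fun x => r_rho r (proj1_sig x)
|}.

Lemma restr_is_realisation (A : ges) (r : realisation A) e :
  is_realisation r -> is_realisation (restr r e).
Proof.
  intros (Rr & Rt & Ra & Rf & Rc). split; [|split; [|split; [|split]]]; simpl.
  - auto.
  - eauto.
  - intros a b H1 H2. apply sig_eq. auto.
  - intros a. apply (finite_sig (fun x => r_le r x e) (Rf (proj1_sig a))).
  - intros x Hx.
    replace (timage (fun a : {x | r_le r x e} => r_rho r (proj1_sig a)) x) with
      (timage (r_rho r) (timage (@proj1_sig _ _) x)).
    + apply Rc. intros a b [b0 [Hb <-]] Hle.
      assert (Ha : r_le r a e) by (eapply Rt; [exact Hle|exact (proj2_sig b0)]).
      exists (exist _ a Ha). split; [|reflexivity]. apply (Hx _ b0 Hb). exact Hle.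
    + apply pred_ext. intros c. split.
      * intros [a [[a0 [Ha <-]] Hc]]. exists a0. auto.
      * intros [a [Ha Hc]]. exists (proj1_sig a). split; [exists a; auto|exact Hc].
Qed.

Lemma restr_map (A : ges) (r : realisation A) e :
  is_real_map r (restr r e) (sub_opt (fun x => r_le r x e)).
Proof.
  apply real_map_intro.
  - intros x. exists (proj1_sig x). apply sub_opt_Some. reflexivity.
  - intros b b' a' E Hle. apply sub_opt_Some in E. subst b.
    exists (proj1_sig a'). split; [exact Hle|]. apply sub_opt_Some. reflexivity.
  - intros a a' E. apply sub_opt_Some in E. subst a. reflexivity.
Qed.

Lemma restr_extremal (A : ges) (r : realisation A) e :
  is_realisation r -> is_extremal r -> is_extremal (restr r e).
Proof.
  intros R X.
  exact (extremal_image (r' := restr r e) R X (restr_is_realisation e R) (restr_map _ e)).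
Qed.

Definition restr_max (A : ges) (r : realisation A) e (R : is_realisation r) : r_ev (restr r e) :=
  exist (fun x => r_le r x e) e (proj1 R e).

Lemma restr_top (A : ges) (r : realisation A) e (R : is_realisation r) :
  is_top (restr r e) (restr_max e R).
Proof. intros [x Hx]. exact Hx. Qed.

(** Everything in [s] lies below [t], the image of [e], so lifting finds preimages below [e] and the
    restricted function is still onto. *)
Lemma restr_codomain_map (A : ges) (r s : realisation A) m e t :
  is_realisation r -> is_real_map r s m -> is_top s t -> m e = Some t ->
  is_real_map (restr r e) s (fun x => m (proj1_sig x)).
Proof.
  intros R M Ht E. apply real_map_intro.
  - intros s0. destruct (real_map_lift R M E (Ht s0)) as [a [Ha Ea]].
    exists (exist _ a Ha). exact Ea.
  - intros b b' a' Eb Hle. destruct (real_map_lift R M Eb Hle) as [a [Ha Ea]].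
    destruct R as (_ & Rt & _).
    assert (H : r_le r a e) by (eapply Rt; [exact Ha|exact (proj2_sig b)]).
    exists (exist _ a H). auto.
  - intros a a' Ea. apply M, Ea.
Qed.

Lemma extremal_map_restr_iso (A : ges) (r s : realisation A) m e t :
  is_realisation r -> is_extremal r -> is_realisation s -> is_real_map r s m ->
  is_top s t -> m e = Some t -> real_isomorphic s (restr r e).
Proof.
  intros R X S M Ht E. apply real_isomorphic_sym. eexists.
  refine (extremal_top_map_iso (restr_is_realisation e R) (restr_extremal R X) S
    (restr_codomain_map e R M Ht E) (restr_top R) _).
  exact E.
Qed.

(* Induction on the number of pairs in the order: a total map that is not an
   isomorphism either identifies two events or drops a pair. *)
Lemma map_to_extremal (A : ges) (r : realisation A) t :
  is_realisation r -> is_top r t ->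
  exists s u g, is_realisation s /\ is_extremal s /\ is_top s u /\
    is_real_map r s g /\ g t = Some u.
Proof.
  intros R Ht.
  assert (exists L, forall a b, r_le r a b -> In (a, b) L) as [L HL].
  { destruct R as (_ & _ & _ & Rf & _). destruct (Rf t) as [l Hl].
    exists (list_prod l l). intros a b _. apply in_prod; apply Hl, Ht. }
  remember (length L) as n eqn:En. revert r t R Ht L HL En.
  induction n as [n IH] using (well_founded_induction lt_wf).
  intros r t R Ht L HL En.
  destruct (classic (is_extremal r)) as [X|X].
  { exists r, t, (fun e => Some e).
    split; [exact R|]. split; [exact X|]. split; [exact Ht|].
    split; [apply real_map_id|reflexivity]. }
  assert (exists r' g, is_realisation r' /\ is_real_map r r' g /\ total_map g /\
    ~ is_real_iso r r' g) as (r' & g & R' & G & T & NI).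
  { apply NNPP. intros N. apply X. intros r' g R' G T. apply NNPP. intros NI.
    apply N. exists r', g. auto. }
  destruct (T t) as [t' Et].
  (* [g] need not send the top to a top; cutting the target down to the part below [t'] restores
     one. *)
  pose proof (real_map_comp R R' G (restr_map _ t')) as C.
  set (k := fun e => option_bind (sub_opt (fun x => r_le r' x t')) (g e)) in C.
  pose proof (restr_is_realisation t' R') as RR.
  assert (Ek : k t = Some (restr_max t' R')).
  { unfold k. rewrite Et. simpl. apply sub_opt_Some. reflexivity. }
  assert (exists p, In p L /\ forall a' b', r_le (restr r' t') a' b' ->
    exists a b, In (a, b) (remove classical_eq_dec p L) /\
      k a = Some a' /\ k b = Some b') as [p [Hp Hrem]].
  { assert (Hcov : forall a' b', r_le (restr r' t') a' b' ->
      exists a b, r_le r a b /\ k a = Some a' /\ k b = Some b').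
    { intros a' b' Hle. destruct (proj1 C b') as [b Hb].
      destruct (real_map_lift R C Hb Hle) as [a [Ha Ea]]. eauto. }
    apply NNPP. intros N. apply NI. apply real_iso_intro; auto.
    - intros a b c Ea Eb. apply NNPP. intros Nab. apply N.
      exists (a, a). split; [apply HL, R|]. intros a' b' Hle.
      destruct (Hcov a' b' Hle) as (x & y & Hxy & Ex & Ey).
      destruct (classic ((x, y) = (a, a))) as [E|E].
      + injection E as -> ->.
        assert (Hk : k b = k a) by (unfold k; rewrite Ea, Eb; reflexivity).
        exists b, b. split; [|rewrite Hk; auto].
        apply in_in_remove; [congruence|]. apply HL, R.
      + exists x, y. split; [|auto]. apply in_in_remove; auto.
    - intros a b a' b' Ea Eb Hab. apply NNPP. intros Nab. apply N.
      exists (a, b). split; [apply HL, Hab|]. intros x' y' Hle.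
      destruct (Hcov x' y' Hle) as (x & y & Hxy & Ex & Ey).
      exists x, y. split; [|auto]. apply in_in_remove; [|auto].
      intros [= -> ->]. apply Nab.
      unfold k in Ex, Ey. rewrite Ea in Ex. rewrite Eb in Ey. simpl in Ex, Ey.
      apply sub_opt_Some in Ex, Ey. subst a' b'. exact Hle. }
  (* The images of the remaining pairs list the target order, and there are fewer than [n] of
     them. *)
  set (kk := fun p : r_ev r * r_ev r =>
    match k (fst p), k (snd p) with Some a, Some b => Some (a, b) | _, _ => None end).
  pose proof (length_omap kk (remove classical_eq_dec p L)) as Hlen.
  pose proof (remove_length_lt classical_eq_dec L p Hp) as Hlt.
  assert (Hn : length (omap kk (remove classical_eq_dec p L)) < n) by lia.
  destruct (IH _ Hn (restr r' t') (restr_max t' R') RR (restr_top R')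
    (omap kk (remove classical_eq_dec p L))) as (s & u & g' & S & XS & Hu & G' & Eu).
  - intros a' b' Hle. apply in_omap. destruct (Hrem a' b' Hle) as (a & b & Hin & Ea & Eb).
    exists (a, b). split; [exact Hin|]. unfold kk. simpl. rewrite Ea, Eb. reflexivity.
  - reflexivity.
  - exists s, u, (fun e => option_bind g' (k e)).
    split; [exact S|]. split; [exact XS|]. split; [exact Hu|]. split.
    + apply (real_map_comp R RR C G').
    + rewrite Ek. exact Eu.
Qed.

(* Realisations with a top are compared with the events of [er A Rep], which live in a
   larger universe; a finite order on any type is therefore re-indexed by [nat]. *)
Lemma small_realisation (A : ges) (T : Type) (leT : T -> T -> Prop) (rho : T -> gev A) :
  finite_set (fun _ : T => True) ->
  (forall a, leT a a) ->
  (forall a b c, leT a b -> leT b c -> leT a c) ->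
  (forall a b, leT a b -> leT b a -> a = b) ->
  (forall x : T -> Prop, (forall a b, x b -> leT a b -> x a) -> ges_config A (timage rho x)) ->
  exists (r : realisation A) (phi : r_ev r -> T) (psi : T -> r_ev r),
    is_realisation r /\ (forall e, psi (phi e) = e) /\ (forall t, phi (psi t) = t) /\
    (forall a b, r_le r a b <-> leT (phi a) (phi b)) /\
    (forall e, r_rho r e = rho (phi e)).
Proof.
  intros [l0 Hl0] Hr Ht Ha Hc.
  (* Events are indexed by their positions in an enumeration without repetition, which makes [phi]
     and [psi] inverse to each other. *)
  set (l := nodup classical_eq_dec l0).
  assert (Hl : forall t, In t l) by (intros t; apply nodup_In, Hl0; exact I).
  assert (Hnd : NoDup l) by apply NoDup_nodup.
  assert (H1 : forall i : {i | i < length l}, exists t, nth_error l (proj1_sig i) = Some t).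
  { intros [i Hi]. simpl. destruct (nth_error l i) eqn:E; [eauto|].
    apply nth_error_None in E. lia. }
  assert (H2 : forall t, exists i : {i | i < length l}, nth_error l (proj1_sig i) = Some t).
  { intros t. destruct (In_nth_error _ _ (Hl t)) as [i Hi].
    assert (Hlt : i < length l) by (apply nth_error_Some; congruence).
    exists (exist _ i Hlt). exact Hi. }
  destruct (choice _ H1) as [phi Hphi]. destruct (choice _ H2) as [psi Hpsi].
  assert (K1 : forall e, psi (phi e) = e).
  { intros e. apply sig_eq. apply (proj1 (NoDup_nth_error l) Hnd).
    - exact (proj2_sig (psi (phi e))).
    - rewrite Hpsi, Hphi. reflexivity. }
  assert (K2 : forall t, phi (psi t) = t).
  { intros t. specialize (Hphi (psi t)). rewrite Hpsi in Hphi. congruence. }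
  exists {| r_ev := {i | i < length l}; r_le := fun a b => leT (phi a) (phi b);
            r_rho := fun e => rho (phi e) |}, phi, psi.
  split; [|simpl; tauto].
  split; [|split; [|split; [|split]]]; simpl.
  - auto.
  - eauto.
  - intros a b Hab Hba. rewrite <- (K1 a), <- (K1 b). f_equal. auto.
  - intros e. apply (@finite_subset _ _ (timage psi (fun _ => True))).
    + apply finite_timage. exists l0. exact Hl0.
    + intros e' _. exists (phi e'). auto.
  - intros x Hx.
    replace (timage (fun e => rho (phi e)) x) with (timage rho (fun t => x (psi t))).
    + apply Hc. intros a b Hb Hle. apply (Hx _ _ Hb). simpl. rewrite !K2. exact Hle.
    + apply pred_ext. intros c. split.
      * intros [t [Hxt Hct]]. exists (psi t). rewrite K2. auto.
      * intros [e [He Hce]]. exists (phi e). rewrite K1. auto.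
Qed.

(** * The events of [er A Rep] *)

Lemma rep_properties (A : ges) (Rep : trealisation A -> Prop) :
  is_rep_choice Rep -> forall p : er_ev Rep,
  is_realisation (tr (proj1_sig p)) /\ is_extremal (tr (proj1_sig p)) /\
  is_top (tr (proj1_sig p)) (ttop (proj1_sig p)).
Proof. intros H p. apply H, (proj2_sig p). Qed.

Lemma rep_iso_eq (A : ges) (Rep : trealisation A -> Prop) :
  is_rep_choice Rep -> forall p q : er_ev Rep,
  real_isomorphic (tr (proj1_sig p)) (tr (proj1_sig q)) -> p = q.
Proof. intros H p q E. apply sig_eq. apply H; auto; apply proj2_sig. Qed.

Lemma maxA_iso (A : ges) (Rep : trealisation A -> Prop) (p : er_ev Rep) r t :
  is_rep_choice Rep -> is_realisation r -> is_top r t ->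
  real_isomorphic (tr (proj1_sig p)) r -> maxA p = r_rho r t.
Proof.
  intros H R Ht [g G]. destruct (rep_properties H p) as (_ & _ & Hp).
  pose proof (iso_top R G Hp Ht) as E. destruct G as [(_ & _ & Hr) _].
  symmetry. apply Hr, E.
Qed.

Lemma restr_rep_exists (A : ges) (Rep : trealisation A -> Prop) r e :
  is_rep_choice Rep -> is_realisation r -> is_extremal r ->
  exists p : er_ev Rep, real_isomorphic (tr (proj1_sig p)) (restr r e).
Proof.
  intros (_ & H & _) R X.
  destruct (H _ _ (restr_is_realisation e R) (restr_extremal R X) (restr_top R))
    as [t [Ht I]].
  exists (exist _ t Ht). exact I.
Qed.

Lemma restr_rep_unique (A : ges) (Rep : trealisation A -> Prop) r e (p q : er_ev Rep) :
  is_rep_choice Rep -> is_realisation r ->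
  real_isomorphic (tr (proj1_sig p)) (restr r e) ->
  real_isomorphic (tr (proj1_sig q)) (restr r e) -> p = q.
Proof.
  intros H R Ip Iq. apply (rep_iso_eq H).
  apply real_isomorphic_trans with (restr r e); auto using real_isomorphic_sym;
    try apply rep_properties; auto.
  apply restr_is_realisation, R.
Qed.

Arguments restr_rep_unique {A Rep r e p q} _ _ _ _.

(** A preimage of the top of [p] is the event to restrict to; together with [restr_rep_le] this says
    that the events of [er A Rep] below a given one are its restrictions. *)
Lemma map_onto_rep (A : ges) (Rep : trealisation A -> Prop) r (p : er_ev Rep) m :
  is_rep_choice Rep -> is_realisation r -> is_extremal r ->
  is_real_map r (tr (proj1_sig p)) m ->
  exists e, m e = Some (ttop (proj1_sig p)) /\
    real_isomorphic (tr (proj1_sig p)) (restr r e).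
Proof.
  intros H R X M. destruct (rep_properties H p) as (P & _ & Hp).
  destruct (proj1 M (ttop (proj1_sig p))) as [e E]. exists e. split; [exact E|].
  apply (extremal_map_restr_iso e R X P M Hp E).
Qed.

Lemma er_le_refl (A : ges) (Rep : trealisation A -> Prop) (p : er_ev Rep) : er_le p p.
Proof. eexists. apply real_map_id. Qed.

Lemma er_le_trans (A : ges) (Rep : trealisation A -> Prop) (p q s : er_ev Rep) :
  is_rep_choice Rep -> er_le p q -> er_le q s -> er_le p s.
Proof.
  intros H [m M] [n N]. eexists.
  refine (real_map_comp _ _ N M); apply (rep_properties H).
Qed.

(** The two maps compose to a partial surjection of a finite realisation onto itself, which is
    total; so is its first factor, and extremality makes that an isomorphism. *)
Lemma er_le_antisym (A : ges) (Rep : trealisation A -> Prop) (p q : er_ev Rep) :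
  is_rep_choice Rep -> er_le p q -> er_le q p -> p = q.
Proof.
  intros H [m M] [n N]. apply (rep_iso_eq H). exists n.
  destruct (rep_properties H p) as (P & _ & Hp).
  destruct (rep_properties H q) as (Q & _ & _).
  destruct (rep_properties H p) as (_ & X & _). apply X; auto.
  assert (T : total_map (fun e => option_bind m (n e))).
  { refine (@partial_surjection_total _ _ _ _).
    - destruct P as (_ & _ & _ & Pf & _). apply (finite_subset (Pf (ttop (proj1_sig p)))).
      intros e _. apply Hp.
    - apply (real_map_comp P Q N M). }
  intros e. destruct (T e) as [e' E]. apply option_bind_Some in E.
  destruct E as [u [E _]]. eauto.
Qed.

Lemma restr_rep_le (A : ges) (Rep : trealisation A -> Prop) (p q : er_ev Rep) e :
  is_rep_choice Rep -> real_isomorphic (tr (proj1_sig q)) (restr (tr (proj1_sig p)) e) ->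
  er_le q p.
Proof.
  intros H I. destruct (rep_properties H p) as (P & _ & _).
  apply real_isomorphic_sym in I. destruct I as [i [I _]]. eexists.
  exact (real_map_comp P (restr_is_realisation e P) (restr_map _ e) I).
Qed.

(** The realisation [p] contains a securing chain for its own top: the label of each of its events
    [e] is [maxA] of the representative of [p] restricted below [e], which is in [Y] by
    down-closure. *)
Lemma maxA_down_closed_config (A : ges) (Rep : trealisation A -> Prop) (Y : er_ev Rep -> Prop) :
  is_rep_choice Rep -> (forall p q, Y p -> er_le q p -> Y q) ->
  ges_consistent A (timage (@maxA A Rep) Y) -> ges_config A (timage (@maxA A Rep) Y).
Proof.
  intros H HY Hc. split; [exact Hc|]. intros c [p [Hp <-]].
  destruct (rep_properties H p) as (P & X & _).
  pose proof P as (_ & _ & _ & _ & Pc).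
  destruct (Pc (fun _ => True)) as [_ Hs]; [intros ?; auto|].
  destruct (Hs (maxA p)) as [l Hl]; [exists (ttop (proj1_sig p)); auto|].
  exists l. refine (securing_chain_subset _ Hl).
  intros c [e [_ <-]]. destruct (restr_rep_exists e H P X) as [q I].
  exists q. split; [apply (HY p q Hp), (restr_rep_le _ _ H I)|].
  apply (maxA_iso _ H (restr_is_realisation e P) (restr_top P) I).
Qed.

(** This is the inductive step in the construction of [h]: [y] stands for the values taken strictly
    below an event of [Q] that is to get label [a]. *)
Lemma er_extension (A : ges) (Rep : trealisation A -> Prop) (y : er_ev Rep -> Prop) a :
  is_ges A -> is_rep_choice Rep -> finite_set y ->
  (forall p q, y p -> er_le q p -> y q) ->
  ges_consistent A (fun b => timage (@maxA A Rep) y b \/ b = a) ->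
  genab A (timage (@maxA A Rep) y) a ->
  exists p, maxA p = a /\ forall q, er_le q p -> q = p \/ y q.
Proof.
  intros HA H Hf Hd Hc Hen.
  (* [None] is the new top, labelled [a], above the events of [y] in their own order. *)
  destruct (@small_realisation A (option {p | y p})
    (fun u v => match u, v with
      | _, None => True
      | None, Some _ => False
      | Some p, Some q => er_le (proj1_sig p) (proj1_sig q) end)
    (fun u => match u with None => a | Some p => maxA (proj1_sig p) end))
    as (r & phi & psi & R & K1 & K2 & Kle & Krho).
  - apply (@finite_subset _ _ (fun u => timage Some (fun _ : {p | y p} => True) u \/ u = None)).
    + destruct (finite_timage Some (finite_sig_all Hf)) as [l Hl].
      exists (None :: l). intros u. simpl. rewrite Hl. intuition congruence.
    + intros [p|] _; [left; exists p; auto | auto].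
  - intros [p|]; auto using er_le_refl.
  - intros [p|] [q|] [s|]; try tauto. apply er_le_trans, H.
  - intros [p|] [q|]; try tauto. intros H1 H2. f_equal. apply sig_eq.
    apply (er_le_antisym H H1 H2).
  - intros x Hx.
    assert (Hdown : forall Y : er_ev Rep -> Prop, subset Y y ->
      (forall p q, Y p -> er_le q p -> Y q) -> ges_config A (timage (@maxA A Rep) Y)).
    { intros Y HYy HY. apply maxA_down_closed_config; auto.
      intros Z HZ Hs. apply Hc; auto. intros c Hcz. left.
      destruct (Hs c Hcz) as [p [Hp E]]. exists p. auto. }
    (* A down-closed set containing the new top is everything, with the labels of [y] and [a]; any
       other is a down-closed part of [y]. *)
    destruct (classic (x None)) as [Hn|Hn].
    + replace (timage _ x) with (fun b => timage (@maxA A Rep) y b \/ b = a).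
      * apply config_add_enabled; auto.
        -- apply Hdown; [intros ? ?; auto|exact Hd].
        -- apply finite_timage, Hf.
      * apply pred_ext. intros c. split.
        -- intros [[p [Hp E]] | ->]; [|exists None; auto].
           exists (Some (exist _ p Hp)). split; [|exact E]. apply (Hx (Some _) None Hn I).
        -- intros [[p|] [Hp E]]; [|auto]. left. exists (proj1_sig p).
           split; [exact (proj2_sig p)|exact E].
    + replace (timage _ x) with
        (timage (@maxA A Rep) (fun p => exists Hp : y p, x (Some (exist _ p Hp)))).
      * apply Hdown; [intros p [Hp _]; exact Hp|].
        intros p q [Hp Hxp] Hle. exists (Hd p q Hp Hle). apply (Hx _ _ Hxp). exact Hle.
      * apply pred_ext. intros c. split.
        -- intros [p [[Hp Hxp] E]]. eexists. split; [exact Hxp|exact E].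
        -- intros [[[p Hp]|] [Hxp E]]; [|contradiction]. exists p. split; [eauto|exact E].
  - assert (Htop : is_top r (psi None)).
    { intros e. apply Kle. rewrite K2. destruct (phi e); exact I. }
    destruct (map_to_extremal R Htop) as (s & u & g & S & X & Hu & G & Eu).
    destruct (proj1 (proj2 H) s u S X Hu) as [t [Ht It]].
    set (p := exist _ t Ht : er_ev Rep).
    assert (Ip : real_isomorphic (tr (proj1_sig p)) s) by exact It.
    clearbody p. clear t Ht It. exists p. split.
    { rewrite (maxA_iso _ H S Hu Ip). destruct G as (_ & _ & Gr).
      rewrite (Gr _ _ Eu), Krho, K2. reflexivity. }
    intros q [m M].
    destruct (rep_properties H p) as (P & XP & Hp).
    destruct (rep_properties H q) as (Q & XQ & Hq).
    apply real_isomorphic_sym in Ip. destruct Ip as [i Ii].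
    pose proof (iso_top P Ii Hu Hp) as Ei. destruct Ii as [Mi _].
    pose proof (real_map_comp R P (real_map_comp R S G Mi) M) as K.
    (* [k] runs from [r] through [s] and [p] to [q]; the cases below depend on which event [e] of
       [r] it sends to the top of [q]. *)
    set (k := fun e => option_bind m (option_bind i (g e))) in K.
    destruct (proj1 K (ttop (proj1_sig q))) as [e Ee].
    destruct (phi e) as [[p0 Hp0]|] eqn:Epe.
    (* If [e] is some [p0] in [y], then [q] is below [p0]: the map sends an event [x] of [p0] to the
       value of [k] at [part x], the representative of [p0] restricted below [x]. *)
    + right. apply (Hd p0 q Hp0).
      destruct (rep_properties H p0) as (P0 & X0 & Ht0).
      destruct (choice _ (fun x => restr_rep_exists (Rep := Rep) x H P0 X0)) as [part Hpart].
      assert (Hy : forall x, y (part x)).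
      { intros x. apply (Hd p0 (part x) Hp0), (restr_rep_le _ _ H (Hpart x)). }
      exists (fun x => k (psi (Some (exist _ (part x) (Hy x))))).
      apply real_map_intro.
      (* An event of [q] lifts to some [p1] below [p0], which is [part x] for some [x]. *)
      * intros c. destruct (real_map_lift R K Ee (Hq c)) as [b [Hb Eb]].
        apply Kle in Hb. rewrite Epe in Hb.
        destruct (phi b) as [[p1 Hp1]|] eqn:Epb; [|contradiction].
        simpl in Hb. destruct Hb as [n N].
        destruct (map_onto_rep _ H P0 X0 N) as [x [_ Hx]]. exists x.
        rewrite <- Eb, <- (K1 b), Epb. do 3 f_equal. apply sig_eq. simpl.
        apply (restr_rep_unique H P0 (Hpart x) Hx).
      * intros x c c' Ex Hle. destruct (real_map_lift R K Ex Hle) as [b [Hb Eb]].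
        apply Kle in Hb. rewrite K2 in Hb.
        destruct (phi b) as [[p1 Hp1]|] eqn:Epb; [|contradiction].
        simpl in Hb. destruct Hb as [n N].
        destruct (rep_properties H (part x)) as (Px & _ & _).
        destruct (real_isomorphic_sym (Hpart x)) as [j [J _]].
        pose proof (restr_is_realisation x P0) as RX.
        (* Factoring the map from [p0] to [p1] through the restriction below [x] forces [x1] to lie
           below [x]. *)
        destruct (map_onto_rep _ H P0 X0
          (real_map_comp P0 Px (real_map_comp P0 RX (restr_map _ x) J) N))
          as [x1 [E1 Hx1]].
        apply option_bind_Some in E1. destruct E1 as [v [E1 _]].
        apply option_bind_Some in E1. destruct E1 as [w [E1 _]].
        apply sub_opt_Some in E1. exists x1. split.
        -- rewrite <- E1. exact (proj2_sig w).
        -- rewrite <- Eb, <- (K1 b), Epb. do 3 f_equal. apply sig_eq. simpl.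
           apply (restr_rep_unique H P0 (Hpart x1) Hx1).
      * intros x c Ex. destruct K as (_ & _ & Kr). rewrite (Kr _ _ Ex), Krho, K2. simpl.
        apply (maxA_iso _ H (restr_is_realisation x P0) (restr_top P0) (Hpart x)).
    (* If [e] is the new top, [m] sends top to top, hence is an isomorphism. *)
    + left. rewrite <- (K1 e), Epe in Ee. unfold k in Ee.
      rewrite Eu in Ee. simpl in Ee. rewrite Ei in Ee. simpl in Ee.
      symmetry. apply (rep_iso_eq H). exists m.
      apply (extremal_top_map_iso P XP Q M Hp Ee).
Qed.

(** * The mediating map *)

(** The recursion picks a value satisfying [C] relative to the set of earlier values when there is
    one. That one exists can thus be proved afterwards, when the earlier values are known to behave
    well. *)
Lemma wf_partial_choice {T U : Type} (lt : T -> T -> Prop) (C : T -> (U -> Prop) -> U -> Prop) :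
  well_founded lt ->
  exists h : T -> option U, forall q,
    match h q with
    | Some p => C q (fun p' => exists q', lt q' q /\ h q' = Some p') p
    | None => forall p, ~ C q (fun p' => exists q', lt q' q /\ h q' = Some p') p
    end.
Proof.
  intros W.
  set (Y := fun q (rec : forall q', lt q' q -> option U) p' =>
    exists q' (H : lt q' q), rec q' H = Some p').
  set (F := fun q rec =>
    match excluded_middle_informative (exists p, C q (Y q rec) p) with
    | left H => Some (proj1_sig (constructive_indefinite_description _ H))
    | right _ => None
    end).
  exists (Fix W (fun _ => option U) F). intros q.
  rewrite Fix_eq.
  2:{ intros x r1 r2 E. f_equal. apply functional_extensionality_dep. intros q'.
      apply functional_extensionality. apply E. }
  replace (fun p' => exists q', lt q' q /\ Fix W (fun _ => option U) F q' = Some p')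
    with (Y q (fun q' _ => Fix W (fun _ => option U) F q')).
  - unfold F at 1. destruct (excluded_middle_informative _) as [H|H].
    + apply proj2_sig.
    + intros p Hp. apply H. exists p. exact Hp.
  - apply pred_ext. intros p'. unfold Y. split.
    + intros [q' [H E]]. eauto.
    + intros [q' [H E]]. eauto.
Qed.

(** A list covering the strict predecessors of an event gets shorter on descending to one of them,
    since that one can be removed. *)
Lemma finite_down_sets_wf {T : Type} (leT : T -> T -> Prop) :
  (forall a b c, leT a b -> leT b c -> leT a c) ->
  (forall a b, leT a b -> leT b a -> a = b) ->
  (forall a, finite_set (fun b => leT b a)) ->
  well_founded (fun a b => leT a b /\ a <> b).
Proof.
  intros Ht Ha Hf q.
  assert (K : forall (l : list T) q, (forall q', leT q' q -> q' <> q -> In q' l) ->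
    Acc (fun a b => leT a b /\ a <> b) q).
  { intros l. remember (length l) as n eqn:En. revert l En.
    induction n as [n IH] using (well_founded_induction lt_wf).
    intros l En p Hp. constructor. intros p' [Hle Hne].
    apply (IH (length (remove classical_eq_dec p' l))) with (remove classical_eq_dec p' l).
    - subst n. apply remove_length_lt. auto.
    - reflexivity.
    - intros p'' Hle' Hne'. apply in_in_remove; [exact Hne'|]. apply Hp; [eauto|].
      intros ->. apply Hne'. auto. }
  destruct (Hf q) as [l Hl]. apply (K l). intros q' Hq' _. apply Hl, Hq'.
Qed.

(** * Equivalence classes and the general event structure on them *)

Lemma clsOf_eq (P : ese) (p q : ev P) : is_ese P -> (clsOf P p = clsOf P q <-> eqv P p q).
Proof.
  intros (_ & _ & _ & _ & _ & _ & _ & _ & _ & Er & Es & Et). split.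
  - intros E. apply (f_equal (@proj1_sig _ _)) in E. simpl in E. rewrite E. apply Er.
  - intros E. apply sig_eq. simpl. apply pred_ext. intros x. split; eauto.
Qed.

Lemma clsOf_repr (P : ese) (c : cls P) : clsOf P (repr c) = c.
Proof.
  apply sig_eq. simpl. unfold repr.
  destruct (constructive_indefinite_description _ _) as [p Hp]. simpl. auto.
Qed.

Lemma repr_clsOf_er (A : ges) (Rep : trealisation A -> Prop) (p : er_ev Rep) :
  maxA_ges (clsOf (er A Rep) p) = maxA p.
Proof.
  (* Equal classes are equal predicates; evaluated at [p], the equation turns the goal into
     [maxA p = maxA p]. *)
  pose proof (f_equal (fun c => proj1_sig c p) (clsOf_repr (clsOf (er A Rep) p))) as E.
  simpl in E. unfold maxA_ges. rewrite E. reflexivity.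
Qed.

(** [ges_map] evaluates [h] at an arbitrary representative, and preservation of equivalence makes
    the label independent of it. Commutation with [f] thus becomes an equation on events of [Q]. *)
Lemma maxA_after_clsOf (A : ges) (Rep : trealisation A -> Prop) (Q : ese)
    (h : ev Q -> option (ev (er A Rep))) q :
  is_ese Q -> (forall q1 q2, eqv Q q1 q2 -> opt_rel (eqv (er A Rep)) (h q1) (h q2)) ->
  maxA_after h (clsOf Q q) = option_map (@maxA A Rep) (h q).
Proof.
  intros HQ Hh. unfold maxA_after, ges_map.
  pose proof (Hh (repr (clsOf Q q)) q) as E.
  rewrite <- clsOf_eq, clsOf_repr in E by exact HQ. specialize (E eq_refl).
  destruct (h (repr (clsOf Q q))) as [p|], (h q) as [p'|]; simpl in *; try tauto.
  rewrite repr_clsOf_er. congruence.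
Qed.

Lemma ges_of_con_image (P : ese) (Y : ev P -> Prop) :
  con P Y -> gcon (ges_of P) (timage (clsOf P) Y).
Proof.
  intros H. exists Y. split; [exact H|]. intros c. unfold timage. firstorder.
Qed.

Lemma con_down_set (Q : ese) q : is_ese Q -> con Q (fun q' => le Q q' q).
Proof.
  intros (_ & _ & _ & _ & _ & Hf & H1 & Hs & He & _).
  (* [q] is kept in every set, so that the axiom adding an event below a member applies at each
     addition. *)
  assert (K : forall l, (forall q', In q' l -> le Q q' q) ->
    con Q (fun q' => In q' l \/ q' = q)).
  { induction l as [|a l IH]; intros Hl.
    - apply (Hs _ _ (H1 q)). intros x [[]|E]. exact E.
    - apply (Hs _ (fun x => (In x l \/ x = q) \/ x = a)).
      + apply (He _ a q); [apply IH; simpl in Hl; auto | auto | apply Hl; simpl; auto].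
      + intros x Hx. simpl in Hx. intuition. }
  destruct (Hf q) as [l Hl]. refine (Hs _ _ (K l _) _).
  - intros q' Hq'. apply Hl, Hq'.
  - intros q' Hq'. left. apply Hl, Hq'.
Qed.

Lemma ges_of_enables_strict_down_set (Q : ese) q :
  is_ese Q ->
  genab (ges_of Q) (timage (clsOf Q) (fun q' => le Q q' q /\ q' <> q)) (clsOf Q q).
Proof.
  intros HQ. pose proof HQ as (_ & _ & _ & _ & _ & _ & _ & Hs & _).
  split.
  - apply ges_of_con_image. apply (Hs _ _ (con_down_set q HQ)).
    intros q' [Hq' _]. exact Hq'.
  - exists q. split; [reflexivity|]. intros q' Hle.
    destruct (classic (q' = q)) as [->|N]; [auto|]. left. exists q'. auto.
Qed.

Theorem mainTheorem2 :
  forall (A : ges), is_ges A ->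
  forall (Rep : trealisation A -> Prop), is_rep_choice Rep ->
  forall (Q : ese), is_ese Q ->
  forall (f : gev (ges_of Q) -> option (gev A)), is_ges_map (ges_of Q) A f ->
  exists h : ev Q -> option (ev (er A Rep)),
    is_ese_map Q (er A Rep) h /\
    f = maxA_after h /\
    (forall h' : ev Q -> option (ev (er A Rep)),
       is_ese_map Q (er A Rep) h' -> f = maxA_after h' ->
       ese_map_equiv Q (er A Rep) h' h).
Proof.
  intros A HA Rep H Q HQ f [Fcon Fen].
  pose proof HQ as (_ & Qt & Qa & _ & _ & Qf & _).
  pose proof HA as (_ & _ & Asub & _).
  (* A value at [q] must carry the label that [f] gives to the class of [q], and everything strictly
     below it must be a value of [h] strictly below [q]. *)
  destruct (wf_partial_choice
    (fun q Y (p : er_ev Rep) => f (clsOf Q q) = Some (maxA p) /\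
       forall p', er_le p' p -> p' = p \/ Y p')
    (finite_down_sets_wf (le Q) Qt Qa Qf)) as [h Hh].
  assert (Hdef : forall q p, h q = Some p -> f (clsOf Q q) = Some (maxA p) /\
    forall p', er_le p' p -> exists q', le Q q' q /\ h q' = Some p').
  { intros q p E. specialize (Hh q). rewrite E in Hh. destruct Hh as [Ef Hp].
    split; [exact Ef|]. intros p' Hle. destruct (Hp p' Hle) as [->|(q' & [Hq' _] & E')].
    - exists q. split; [apply HQ|exact E].
    - eauto. }
  (* [h] is defined wherever [f] is: were [h q] undefined while [f] gives [a], [er_extension] would
     supply an admissible value. *)
  assert (Hmax : forall q, f (clsOf Q q) = option_map (@maxA A Rep) (h q)).
  { intros q. induction q as [q IH] using (well_founded_induction
      (finite_down_sets_wf (le Q) Qt Qa Qf)).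
    destruct (h q) as [p|] eqn:E; [apply Hdef, E|].
    destruct (f (clsOf Q q)) as [a|] eqn:Ef; [|reflexivity]. exfalso.
    specialize (Hh q). rewrite E in Hh.
    set (Y := fun p' => exists q', (le Q q' q /\ q' <> q) /\ h q' = Some p') in Hh.
    assert (HY : pimage f (timage (clsOf Q) (fun q' => le Q q' q /\ q' <> q)) =
      timage (@maxA A Rep) Y).
    { apply pred_ext. intros b. split.
      - intros [c [[q' [Hq' <-]] Eb]]. rewrite (IH q' Hq') in Eb.
        destruct (h q') as [p'|] eqn:E'; [|discriminate].
        injection Eb as <-. exists p'. split; [|reflexivity]. exists q'. auto.
      - intros [p' [[q' [Hq' E']] <-]]. exists (clsOf Q q').
        split; [exists q'; auto|]. apply Hdef, E'. }
    destruct (@er_extension A Rep Y a) as [p [<- Hp]]; auto.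
    - apply (@finite_subset _ _ (pimage h (fun q' => le Q q' q))).
      + apply finite_pimage, Qf.
      + intros p' [q' [[Hq' _] E']]. exists q'. auto.
    - intros p p' [q' [[Hq' N] E']] Hle.
      destruct (proj2 (Hdef _ _ E') p' Hle) as [q'' [Hq'' E'']].
      exists q''. split; [split; [eauto|]|exact E''].
      intros ->. apply N. auto.
    - intros X _ HX.
      (* All labels concerned lie in the image under [f] of the classes of the down-set of [q],
         which are consistent. *)
      apply (Asub _ _ (proj1 (Fcon _ (ges_of_con_image _ _ (con_down_set q HQ))))).
      intros b Hb. destruct (HX b Hb) as [Hb'| ->].
      + rewrite <- HY in Hb'. destruct Hb' as [c [[q' [[Hq' _] <-]] Eb]].
        exists (clsOf Q q'). split; [exists q'; auto|exact Eb].
      + exists (clsOf Q q). split; [|exact Ef]. exists q. split; [apply HQ|reflexivity].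
    - rewrite <- HY. apply Fen with (clsOf Q q); [|exact Ef].
      apply ges_of_enables_strict_down_set, HQ.
    - apply (Hh p). split; [exact Ef|exact Hp]. }
  assert (Heqv : forall q1 q2, eqv Q q1 q2 -> opt_rel (eqv (er A Rep)) (h q1) (h q2)).
  { intros q1 q2 E. apply (clsOf_eq q1 q2 HQ) in E.
    pose proof (Hmax q1) as E1. rewrite E, Hmax in E1.
    destruct (h q1), (h q2); simpl in *; try discriminate; [|exact I].
    injection E1. auto. }
  exists h. split; [|split].
  - split; [exact Heqv|]. intros x [[Hxd Hxc] Hxf].
    pose proof (ges_of_con_image Q x (Hxc x Hxf (fun e He => He))) as Hcx.
    destruct (Fcon _ Hcx) as [Hfx Hinj].
    split; [split; [split|]|].
    + intros p' p [q [Hq E]] Hle. destruct (proj2 (Hdef q p E) p' Hle) as [q' [Hq' E']].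
      exists q'. eauto.
    + intros X HX HXh. split; [exact HX|]. apply maxA_down_closed_config; auto.
      * intros p p' [p0 [Hp0 Hle]] Hle'. exists p0. split; [exact Hp0|].
        apply (er_le_trans H Hle' Hle).
      (* The down-closure of [X] consists of values of [h] on [x], so its labels lie in the image
         under [f] of the classes of [x]. *)
      * intros Z _ HZ. apply (Asub _ _ Hfx). intros b Hb.
        destruct (HZ b Hb) as [p [[p0 [Hp0 Hle]] <-]].
        destruct (HXh p0 Hp0) as [q [Hq E]].
        destruct (proj2 (Hdef q p0 E) p Hle) as [q' [Hq' E']].
        exists (clsOf Q q'). split; [exists q'; eauto|]. apply Hdef, E'.
    + apply finite_pimage, Hxf.
    (* Equivalent values share a label, so [f] agrees on the two classes, and [f] is injective on
       the classes of [x]. *)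
    + intros q1 q2 p1 p2 H1 H2 E1 E2 E. apply (clsOf_eq q1 q2 HQ).
      apply (Hinj _ _ (maxA p1)); [exists q1; auto|exists q2; auto|apply Hdef, E1|].
      simpl in E. rewrite E. apply Hdef, E2.
  - apply functional_extensionality. intros c. rewrite <- (clsOf_repr c).
    rewrite maxA_after_clsOf by auto. apply Hmax.
  (* Commutation determines where [h'] is defined and with which label, and equivalence in
     [er A Rep] is equality of labels. *)
  - intros h' [Heqv' _] Hf' q. pose proof (Hmax q) as E. rewrite Hf' in E.
    rewrite maxA_after_clsOf in E by auto.
    destruct (h' q), (h q); simpl in *; try discriminate; [|exact I].
    injection E. auto.
Qed.
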